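(* Let $C\subseteq T^{n-1}_{n,n}$ be a maximal cone. Then the bipartite graph $\Gamma(C)$ consists of a cycle of length $2l$ (for some $l$), and a perfect matching of the remaining $2(n-l)$ vertices. The cone $C$ is positive if and only if $l$ is even.
   Context: $\mathcal C=\bigcup_{m\ge1}\mathbb C((t^{1/m}))$ is the field of Puiseux series with valuation $\operatorname{val}$ (lowest exponent) and leading coefficient $\operatorname{lc}$; $\mathcal C_+=\{x\in\mathcal C\mid\operatorname{lc}(x)\in\mathbb R_{>0}\}$. For $S\subseteq\mathcal C^{N}$, $\operatorname{trop}(S)$ is the closure of $\{\operatorname{val}(z)\mid z\in S\cap(\mathcal C^* )^{N}\}$. $T^{n-1}_{n,n}=\operatorname{trop}(V(\det))$ where $\det=\sum_{\sigma\in S_n}\operatorname{sgn}(\sigma)\prod_ix_{i\sigma(i)}$. It is the codimension-$1$ skeleton of the normal fan of the Birkhoff polytope $B_n$ (convex hull of permutation matrices). Its maximal cones are dual to the edges $\operatorname{conv}(\sigma,\pi)$ of $B_n$ ($\sigma,\pi\in S_n$ form an edge iff $\sigma\pi^{-1}$ is a nontrivial cycle), the dual cone being the set of $w$ such that $\min_\tau\sum_iw_{i\tau(i)}$ is attained at $\sigma$ and $\pi$. A cone is positive if it is contained in $\operatorname{trop}(V(\det)\cap\mathcal C_+^{n\times n})$. For a cone $C$ of $T^{n-1}_{n,n}$, let $\Lambda\subseteq S_n$ be the set of permutations such that $\operatorname{conv}(\Lambda)$ is the face of $B_n$ dual to $C$. $\Gamma(C)$ is the bipartite graph with vertices $\{r_1,\dots,r_n\}\sqcup\{g_1,\dots,g_n\}$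 and edges $r_ig_j$ whenever $\sigma(i)=j$ for some $\sigma\in\Lambda$. (A cycle of length $4=2l$ with $l=2$ is the smallest possible.) *)

(* Defs.v *)
From HB Require Import structures.
From mathcomp Require Import all_boot all_order all_fingroup all_algebra.
From mathcomp Require Import complex.
From mathcomp Require Import all_classical all_reals all_analysis.

Set Implicit Arguments.
Unset Strict Implicit.
Unset Printing Implicit Defensive.

Import Order.TTheory GRing.Theory Num.Theory.
Import numFieldNormedType.Exports.

Local Open Scope classical_set_scope.
Local Open Scope ring_scope.

(** ** The field of Puiseux series *)

(* A series is given by its coefficients: f q is the coefficient of t^q. The
   condition says that f is a Laurent series in t^(1/m): its exponents lie in
   (1/m)Z and are bounded below by N/m. *)
Definition puiseux_axiom (R : realType) (f : rat -> R[i]) : Prop :=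
  exists m : nat, exists N : int, (0 < m)%N /\
    forall q : rat, f q != 0 -> exists k : nat, q = (N + k%:Z)%:~R / m%:R.

Definition is_puiseux (R : realType) : {pred rat -> R[i]} :=
  fun f => `[< puiseux_axiom f >].

Record puiseux (R : realType) := Puiseux {
  pcoef :> rat -> R[i];
  pcoefP : pcoef \in @is_puiseux R
}.

HB.instance Definition _ (R : realType) := [isSub for @pcoef R].
HB.instance Definition _ (R : realType) := [Choice of puiseux R by <:].

Definition puiseux_pt (m : nat) (N : int) (k : nat) : rat := (N + k%:Z)%:~R / m%:R.

Definition supp_in (R : realType) (m : nat) (N : int) (f : rat -> R[i]) : Prop :=
  forall q, f q != 0 -> exists k : nat, q = puiseux_pt m N k.

Lemma puiseux_pt_inj (m : nat) (N : int) : (0 < m)%N -> injective (puiseux_pt m N).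
Proof.
move=> m0 i j; rewrite /puiseux_pt => /(mulIf _).
rewrite invr_eq0 pnatr_eq0 -lt0n m0 => /(_ isT) /eqP.
by rewrite eqr_int => /eqP /addrI [].
Qed.

Lemma puiseux_ptD (m : nat) (N1 N2 : int) (i j : nat) :
  puiseux_pt m N1 i + puiseux_pt m N2 j = puiseux_pt m (N1 + N2) (i + j).
Proof. by rewrite /puiseux_pt -mulrDl -rmorphD /= PoszD addrACA. Qed.

Lemma puiseux_pt_shift (m : nat) (N N' : int) (k : nat) : N' <= N ->
  puiseux_pt m N k = puiseux_pt m N' (`|N - N'| + k).
Proof.
move=> le; rewrite /puiseux_pt PoszD gez0_abs ?subr_ge0//.
by rewrite addrA [N' + _]addrC subrK.
Qed.

Lemma puiseux_pt_scale (m d : nat) (N : int) (k : nat) : (0 < d)%N ->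
  puiseux_pt m N k = puiseux_pt (m * d) (N * d%:Z) (k * d).
Proof.
move=> d0; rewrite /puiseux_pt PoszM -mulrDl rmorphM /= natrM.
have d0' : (d%:R : rat) != 0 by rewrite pnatr_eq0 -lt0n.
by rewrite -mulf_div -[d%:~R]/(d%:R) divff// mulr1.
Qed.

Lemma supp_in_shift (R : realType) m N N' (f : rat -> R[i]) :
  N' <= N -> supp_in m N f -> supp_in m N' f.
Proof. by move=> le Hf q /Hf[k ->]; rewrite (puiseux_pt_shift _ _ le); eexists. Qed.

Lemma supp_in_scale (R : realType) m d N (f : rat -> R[i]) :
  (0 < d)%N -> supp_in m N f -> supp_in (m * d) (N * d%:Z) f.
Proof. by move=> d0 Hf q /Hf[k ->]; rewrite (puiseux_pt_scale _ _ _ d0); eexists. Qed.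

Lemma puiseuxP (R : realType) (f : rat -> R[i]) :
  reflect (exists m N, (0 < m)%N /\ supp_in m N f) (f \in @is_puiseux R).
Proof. exact: asboolP. Qed.

Lemma common_supp (R : realType) (f g : rat -> R[i]) :
  f \in @is_puiseux R -> g \in @is_puiseux R ->
  exists m N, [/\ (0 < m)%N, supp_in m N f & supp_in m N g].
Proof.
move=> /puiseuxP[m1 [N1 [m10 Hf]]] /puiseuxP[m2 [N2 [m20 Hg]]].
exists (m1 * m2)%N, (Num.min (N1 * m2%:Z) (N2 * m1%:Z)); split.
- by rewrite muln_gt0 m10.
- by apply: supp_in_shift (supp_in_scale m20 Hf); rewrite ge_min lexx.
- by rewrite mulnC; apply: supp_in_shift (supp_in_scale m10 Hg); rewrite ge_min lexx orbT.
Qed.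

Lemma common_supp3 (R : realType) (f g h : rat -> R[i]) :
  f \in @is_puiseux R -> g \in @is_puiseux R -> h \in @is_puiseux R ->
  exists m N, [/\ (0 < m)%N, supp_in m N f, supp_in m N g & supp_in m N h].
Proof.
move=> /common_supp/[apply] -[m1 [N1 [m10 Hf Hg]]] /puiseuxP[m2 [N2 [m20 Hh]]].
exists (m1 * m2)%N, (Num.min (N1 * m2%:Z) (N2 * m1%:Z)); split.
- by rewrite muln_gt0 m10.
- by apply: supp_in_shift (supp_in_scale m20 Hf); rewrite ge_min lexx.
- by apply: supp_in_shift (supp_in_scale m20 Hg); rewrite ge_min lexx.
- by rewrite mulnC; apply: supp_in_shift (supp_in_scale m10 Hh); rewrite ge_min lexx orbT.
Qed.

Lemma supp_in0 (R : realType) m N (f : rat -> R[i]) q :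
  supp_in m N f -> (forall k, q <> puiseux_pt m N k) -> f q = 0.
Proof.
by move=> Hf nq; apply/eqP/negPn/negP => /Hf[k /nq].
Qed.

Lemma supp_in_ext (R : realType) m N (f g : rat -> R[i]) :
  supp_in m N f -> supp_in m N g -> (forall k, f (puiseux_pt m N k) = g (puiseux_pt m N k)) ->
  f = g.
Proof.
move=> Hf Hg E; apply/funext => q.
have [[k ->]//|nq] := pselect (exists k, q = puiseux_pt m N k).
by rewrite (supp_in0 Hf) ?(supp_in0 Hg)// => k qk; apply: nq; exists k.
Qed.

Lemma is_puiseux_zmod_closed (R : realType) : zmod_closed (@is_puiseux R).
Proof.
split; first by apply/puiseuxP; exists 1%N, 0; split=> // q; rewrite eqxx.
move=> f g Hf Hg; have [m [N [m0 sf sg]]] := common_supp Hf Hg.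
apply/puiseuxP; exists m, N; split=> // q.
have [fq|/sf//] := eqVneq (f q) 0.
have [gq|/sg//] := eqVneq (g q) 0.
have -> : (f - g) q = f q - g q by [].
by rewrite fq gq subr0 eqxx.
Qed.

HB.instance Definition _ (R : realType) :=
  GRing.isZmodClosed.Build (rat -> R[i]) (@is_puiseux R)
    (@is_puiseux_zmod_closed R).
HB.instance Definition _ (R : realType) :=
  [SubChoice_isSubZmodule of puiseux R by <:].

Definition puiseux_one_fun (R : realType) (q : rat) : R[i] := (q == 0)%:R.

(* The Cauchy product; only finitely many terms of the sum are nonzero. *)
Definition puiseux_mul_fun (R : realType) (f g : rat -> R[i]) (q : rat) : R[i] :=
  \sum_(x \in setT) f x * g (q - x).

Definition puiseux_trunc (R : realType) (m : nat) (N : int) (K : nat)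
  (f : rat -> R[i]) : {poly R[i]} := \poly_(i < K) f (puiseux_pt m N i).

Lemma coefM_trunc (R : realType) (p p' q q' : {poly R[i]}) k :
  (forall i, (i <= k)%N -> p`_i = p'`_i) ->
  (forall i, (i <= k)%N -> q`_i = q'`_i) -> (p * q)`_k = (p' * q')`_k.
Proof.
move=> Hp Hq; rewrite !coefM; apply: eq_bigr => i _.
by rewrite Hp -1?ltnS// Hq// leq_subr.
Qed.

Lemma puiseux_mulE (R : realType) m N1 N2 (f g : rat -> R[i]) K k : (0 < m)%N ->
  supp_in m N1 f -> supp_in m N2 g -> (k < K)%N ->
  puiseux_mul_fun f g (puiseux_pt m (N1 + N2) k) = (puiseux_trunc m N1 K f * puiseux_trunc m N2 K g)`_k.
Proof.
move=> m0 sf sg kK; rewrite /puiseux_mul_fun.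
rewrite (fsbigE [seq puiseux_pt m N1 i | i <- iota 0 k.+1])//; last 2 first.
- by rewrite (map_inj_uniq (puiseux_pt_inj m0)) iota_uniq.
- move=> x _ xk.
  have [->|/sf[i xi]] := eqVneq (f x) 0; first by rewrite mul0r.
  have [->|/sg[j xj]] := eqVneq (g (puiseux_pt m (N1 + N2) k - x)) 0; first by rewrite mulr0.
  have /(puiseux_pt_inj m0) kij : puiseux_pt m (N1 + N2) k = puiseux_pt m (N1 + N2) (i + j).
    by rewrite -puiseux_ptD -xi -xj [x + _]addrC subrK.
  move: xk; rewrite xi (mem_map (puiseux_pt_inj m0)) mem_iota add0n leq0n /= ltnS.
  by rewrite kij leq_addr.
rewrite (eq_bigl xpredT); last by move=> i; rewrite in_setT.
rewrite big_map coefM -[in LHS](subn0 k.+1) -/(index_iota 0 k.+1) big_mkord.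
apply: eq_bigr => i _; rewrite !coef_poly.
have ik : (i <= k)%N by rewrite -ltnS.
rewrite (leq_ltn_trans ik kK) (leq_ltn_trans (leq_subr _ _) kK).
congr (_ * g _); apply/eqP; rewrite subr_eq puiseux_ptD.
by rewrite [N2 + N1]addrC subnK.
Qed.

Lemma puiseux_mul_supp (R : realType) m N1 N2 (f g : rat -> R[i]) :
  supp_in m N1 f -> supp_in m N2 g -> supp_in m (N1 + N2) (puiseux_mul_fun f g).
Proof.
move=> sf sg q; apply: contra_neqP => nq; apply: fsbig1 => x _.
have [->|/sf[i xi]] := eqVneq (f x) 0; first by rewrite mul0r.
have [->|/sg[j xj]] := eqVneq (g (q - x)) 0; first by rewrite mulr0.
by exfalso; apply: nq; exists (i + j)%N; rewrite -puiseux_ptD -xi -xj [x + _]addrC subrK.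
Qed.

Lemma is_puiseux_one (R : realType) : @puiseux_one_fun R \in @is_puiseux R.
Proof.
apply/puiseuxP; exists 1%N, 0; split=> // q; rewrite /puiseux_one_fun.
have [->|_] := eqVneq q 0; last by rewrite eqxx.
by exists 0%N; rewrite /puiseux_pt addr0 mul0r.
Qed.

Lemma is_puiseux_mul (R : realType) (f g : rat -> R[i]) :
  f \in @is_puiseux R -> g \in @is_puiseux R ->
  puiseux_mul_fun f g \in @is_puiseux R.
Proof.
move=> /common_supp/[apply] -[m [N [m0 sf sg]]]; apply/puiseuxP.
by exists m, (N + N); split=> //; exact: (puiseux_mul_supp sf sg).
Qed.

Definition puiseux_one (R : realType) : puiseux R := Puiseux (is_puiseux_one R).
Definition puiseux_mul (R : realType) (f g : puiseux R) : puiseux R :=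
  Puiseux (is_puiseux_mul (pcoefP f) (pcoefP g)).

Lemma puiseux_mulA (R : realType) : associative (@puiseux_mul R).
Proof.
move=> [f Hf] [g Hg] [h Hh]; apply: val_inj => /=.
have [m [N [m0 sf sg sh]]] := common_supp3 Hf Hg Hh.
apply: (@supp_in_ext R m (N + N + N)).
- by rewrite -addrA; exact: (puiseux_mul_supp sf (puiseux_mul_supp sg sh)).
- exact: (puiseux_mul_supp (puiseux_mul_supp sf sg) sh).
move=> k; rewrite -{1}addrA (puiseux_mulE m0 sf (puiseux_mul_supp sg sh) (ltnSn k)).
rewrite (puiseux_mulE m0 (puiseux_mul_supp sf sg) sh (ltnSn k)).
transitivity ((puiseux_trunc m N k.+1 f * (puiseux_trunc m N k.+1 g * puiseux_trunc m N k.+1 h))`_k).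
  apply: coefM_trunc => // i ik.
  by rewrite coef_poly ltnS ik (puiseux_mulE m0 sg sh (K := k.+1)).
rewrite mulrA; apply: coefM_trunc => // i ik.
by rewrite coef_poly ltnS ik (puiseux_mulE m0 sf sg (K := k.+1)).
Qed.

Lemma puiseux_mulC (R : realType) : commutative (@puiseux_mul R).
Proof.
move=> [f Hf] [g Hg]; apply: val_inj => /=.
have [m [N [m0 sf sg]]] := common_supp Hf Hg.
apply: (supp_in_ext (puiseux_mul_supp sf sg) (puiseux_mul_supp sg sf)) => k.
by rewrite (puiseux_mulE m0 sf sg (ltnSn k)) (puiseux_mulE m0 sg sf (ltnSn k)) mulrC.
Qed.

Lemma puiseux_one_supp (R : realType) m : supp_in m 0 (@puiseux_one_fun R).
Proof.
move=> q; rewrite /puiseux_one_fun; have [->|_] := eqVneq q 0; last by rewrite eqxx.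
by exists 0%N; rewrite /puiseux_pt addr0 mul0r.
Qed.

Lemma puiseux_trunc_one (R : realType) m K : (0 < m)%N -> (0 < K)%N ->
  puiseux_trunc m 0 K (@puiseux_one_fun R) = 1.
Proof.
move=> m0 K0; apply/polyP => i; rewrite coef_poly coef1 /puiseux_one_fun.
have -> : (puiseux_pt m 0 i == 0) = (i == 0)%N.
  have <- : puiseux_pt m 0 0 = 0 by rewrite /puiseux_pt addr0 mul0r.
  exact: (inj_eq (puiseux_pt_inj m0)).
by case: ltnP => // Ki; rewrite gtn_eqF// (leq_trans K0).
Qed.

Lemma puiseux_mul1 (R : realType) : left_id (@puiseux_one R) (@puiseux_mul R).
Proof.
move=> [f Hf]; apply: val_inj => /=.
have [m [N [m0 sf]]] := puiseuxP _ Hf.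
apply: (@supp_in_ext R m (0 + N)).
- exact: (puiseux_mul_supp (@puiseux_one_supp R m) sf).
- by rewrite add0r.
move=> k; rewrite (puiseux_mulE m0 (@puiseux_one_supp R m) sf (ltnSn k)).
by rewrite puiseux_trunc_one// mul1r coef_poly ltnSn add0r.
Qed.

Lemma puiseux_mulDl (R : realType) : left_distributive (@puiseux_mul R) +%R.
Proof.
move=> f g [h Hh]; apply: val_inj => /=.
have [m [N [m0 sf sg sh]]] := common_supp3 (pcoefP f) (pcoefP g) Hh.
have sfg : supp_in m N (pcoef (f + g)).
  move=> q /=; have [fq|/sf//] := eqVneq (f q) 0.
  by have [gq|/sg//] := eqVneq (g q) 0; rewrite !fctE fq gq addr0 eqxx.
apply: (@supp_in_ext R m (N + N)); first exact: (puiseux_mul_supp sfg sh).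
  move=> q /=; set a := puiseux_mul_fun f h; set b := puiseux_mul_fun g h.
  have [fq|/(puiseux_mul_supp sf sh)//] := eqVneq (a q) 0.
  by have [gq|/(puiseux_mul_supp sg sh)//] := eqVneq (b q) 0; rewrite !fctE fq gq addr0 eqxx.
move=> k; rewrite !fctE /= (puiseux_mulE m0 sfg sh (ltnSn k)).
rewrite (puiseux_mulE m0 sf sh (ltnSn k)) (puiseux_mulE m0 sg sh (ltnSn k)).
rewrite -coefD -mulrDl; congr (nth 0 (polyseq (_ * _)) k).
by apply/polyP => i; rewrite coefD !coef_poly; case: ifP; rewrite ?addr0.
Qed.

Lemma puiseux_one_neq0 (R : realType) : puiseux_one R != 0.
Proof.
apply/eqP => /(congr1 (fun f : puiseux R => f 0)) /= /eqP.
by rewrite /puiseux_one_fun eqxx oner_eq0.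
Qed.

HB.instance Definition _ (R : realType) :=
  GRing.Zmodule_isComNzRing.Build (puiseux R)
    (@puiseux_mulA R) (@puiseux_mulC R) (@puiseux_mul1 R) (@puiseux_mulDl R) (@puiseux_one_neq0 R).

Lemma puiseux_lowest (R : realType) (f : puiseux R) : f != 0 ->
  exists m N, [/\ (0 < m)%N, supp_in m N f & f (puiseux_pt m N 0) != 0].
Proof.
move=> f0; have [m [N [m0 sf]]] := puiseuxP _ (pcoefP f).
have ex : exists k, f (puiseux_pt m N k) != 0.
  apply: contrapT => /forallNP all0; move/eqP: f0; apply; apply: val_inj => /=.
  apply: (supp_in_ext sf) => [q|k]; first by rewrite eqxx.
  by apply/eqP/negPn/negP/all0.
case: (ex_minnP ex) => k fk kmin.
have ptE i : puiseux_pt m N (k + i) = puiseux_pt m (N + k%:Z) i by rewrite /puiseux_pt PoszD addrA.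
exists m, (N + k%:Z); split=> //; last by rewrite -ptE addn0.
move=> q fq; have [j qj] := sf q fq; exists (j - k)%N.
by rewrite -ptE subnKC// kmin// -qj.
Qed.

Fixpoint inv_seq (F : fieldType) (a : nat -> F) (n : nat) : seq F :=
  if n is n'.+1 then
    let s := inv_seq a n' in
    rcons s ((a 0%N)^-1 * ((n' == 0%N)%:R - \sum_(i < n') a i.+1 * s`_(n' - i.+1)))
  else [::].

Lemma power_series_inv (F : fieldType) (a : nat -> F) : a 0%N != 0 ->
  exists b : nat -> F, forall k,
    \sum_(i < k.+1) a i * b (k - i)%N = (k == 0%N)%:R.
Proof.
move=> a0; have sz n : size (inv_seq a n) = n.
  by elim: n => //= n IH; rewrite size_rcons IH.
have nthE n j : (j < n)%N -> (inv_seq a n)`_j = (inv_seq a j.+1)`_j.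
  elim: n => // n IH; rewrite ltnS leq_eqVlt => /predU1P[->//|jn].
  by rewrite [LHS]/= nth_rcons sz jn IH.
exists (fun n => (inv_seq a n.+1)`_n) => k.
rewrite big_ord_recl subn0 [X in a _ * X]/= nth_rcons sz ltnn eqxx mulrA.
rewrite divff// mul1r.
rewrite -[RHS](subrK (\sum_(i < k) a i.+1 * (inv_seq a k)`_(k - i.+1))).
congr (_ + _); apply: eq_bigr => i _; rewrite lift0; congr (_ * _).
by rewrite nthE// -subSn// subSS leq_subr.
Qed.

Definition puiseux_inv (R : realType) (f : puiseux R) : puiseux R :=
  xget 0 [set g | g * f = 1].

Lemma puiseux_mulVf (R : realType) (f : puiseux R) : f != 0 -> puiseux_inv f * f = 1.
Proof.
move=> /puiseux_lowest[m [N [m0 sf f0]]].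
have [b bE] := @power_series_inv R[i] (fun i => f (puiseux_pt m N i)) f0.
pose z (q : rat) : rat := q * m%:R + N%:~R.
pose g (q : rat) : R[i] := if z q \is a Num.nat then b (Num.truncn (z q)) else 0.
have mn0 : (m%:R : rat) != 0 by rewrite pnatr_eq0 -lt0n.
have zpt k : z (puiseux_pt m (- N) k) = k%:R.
  by rewrite /z /puiseux_pt divfK// -rmorphD /= addrAC addNr add0r.
have gpt k : g (puiseux_pt m (- N) k) = b k by rewrite /g zpt natr_nat natrK.
have sg : supp_in m (- N) g.
  move=> q; rewrite /g; case: ifPn => [/natrP[k zk] _|]; last by rewrite eqxx.
  exists k; rewrite /puiseux_pt rmorphD /= -[k%:~R]/(k%:R) -zk /z.
  by rewrite rmorphN /= addrC addrK mulfK.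
have gP : g \in @is_puiseux R by apply/puiseuxP; exists m, (- N).
rewrite /puiseux_inv; apply: (@xgetPex _ 0 [set g | g * f = 1]).
exists (Puiseux gP); rewrite /= mulrC; apply: val_inj => /=.
apply: (@supp_in_ext R m (N - N)).
- exact: (puiseux_mul_supp sf sg).
- by rewrite subrr; exact: puiseux_one_supp.
move=> k; rewrite (puiseux_mulE m0 sf sg (ltnSn k)) coefM.
transitivity (\sum_(i < k.+1) f (puiseux_pt m N i) * b (k - i)%N).
  by apply: eq_bigr => i _; rewrite !coef_poly ltn_ord ltnS leq_subr gpt.
rewrite bE subrr; move: (@puiseux_trunc_one R m k.+1 m0 isT) => /(congr1 (fun p : {poly _} => p`_k)).
by rewrite coef_poly ltnSn coef1 => ->.
Qed.

Lemma puiseux_inv0 (R : realType) : puiseux_inv (0 : puiseux R) = 0.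
Proof.
rewrite /puiseux_inv; case: xgetP => // g _ /= /eqP.
by rewrite mulr0 eq_sym oner_eq0.
Qed.

HB.instance Definition _ (R : realType) :=
  GRing.ComNzRing_isField.Build (puiseux R) (@puiseux_mulVf R) (@puiseux_inv0 R).

(* The lowest exponent of a nonzero series; puiseux_val 0 = 0 is a dummy value. *)
Definition puiseux_val (R : realType) (f : puiseux R) : rat :=
  xget 0 [set q | f q != 0 /\ forall q', f q' != 0 -> q <= q'].

Lemma puiseux_valP (R : realType) (f : puiseux R) : f != 0 ->
  f (puiseux_val f) != 0 /\ forall q, f q != 0 -> puiseux_val f <= q.
Proof.
move=> /puiseux_lowest[m [N [m0 sf f0]]].
apply: (@xgetPex _ 0 [set q | f q != 0 /\ forall q', f q' != 0 -> q <= q']).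
exists (puiseux_pt m N 0); split=> // q /sf[k ->].
by rewrite /puiseux_pt ler_wpM2r ?invr_ge0 ?ler0n// ler_int lerD2l.
Qed.

Definition puiseux_lc (R : realType) (f : puiseux R) : R[i] := f (puiseux_val f).

(* On R[i], 0 < z means that z is real and positive; puiseux_lc 0 = 0, so that 0 is
   excluded. *)
Definition puiseux_positive (R : realType) : set (puiseux R) :=
  [set f | 0 < puiseux_lc f].

(** ** Tropicalization *)

(* The points with all coordinates nonzero. *)
Definition torus (R : realType) (m n : nat) : set 'M[puiseux R]_(m, n) :=
  [set z : 'M[puiseux R]_(m, n) | forall i j, z i j != 0].

Definition val_mx (R : realType) (m n : nat) (z : 'M[puiseux R]_(m, n)) :
    'M[R]_(m, n) :=
  \matrix_(i, j) ratr (puiseux_val (z i j)).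

Definition trop (R : realType) (m n : nat) (S : set 'M[puiseux R]_(m, n)) :
    set 'M[R]_(m, n) :=
  closure (@val_mx R m n @` (S `&` @torus R m n)).

Definition det_hypersurface (R : realType) (n : nat) : set 'M[puiseux R]_n :=
  [set z : 'M[puiseux R]_n | \det z = 0].

Definition positive_orthant (R : realType) (n : nat) : set 'M[puiseux R]_n :=
  [set z : 'M[puiseux R]_n | forall i j, puiseux_positive (z i j)].

Definition trop_det (R : realType) (n : nat) : set 'M[R]_n :=
  trop (@det_hypersurface R n).

(** ** Faces and normal fan of a polytope *)

Definition mx_dot (R : realType) (n : nat) (w x : 'M[R]_n) : R :=
  \sum_i \sum_j w i j * x i j.

(* Inner normals: the fan follows the min convention. *)
Definition min_face (R : realType) (n : nat) (P : set 'M[R]_n) (w : 'M[R]_n) :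
    set 'M[R]_n :=
  [set x | P x /\ forall y, P y -> mx_dot w x <= mx_dot w y].

Definition is_face (R : realType) (n : nat) (P F : set 'M[R]_n) : Prop :=
  F !=set0 /\ exists w, F = min_face P w.

Definition normal_cone (R : realType) (n : nat) (P F : set 'M[R]_n) :
    set 'M[R]_n :=
  [set w | F `<=` min_face P w].

Definition dual_to (R : realType) (n : nat) (P F C : set 'M[R]_n) : Prop :=
  is_face P F /\ C = normal_cone P F.

Definition normal_fan (R : realType) (n : nat) (P : set 'M[R]_n) :
    set (set 'M[R]_n) :=
  [set C | exists F, dual_to P F C].

(** ** The Birkhoff polytope *)

(* perm_mx s has its ones at the positions (i, s i), so that
   mx_dot w (perm_mx s) = \sum_i w i (s i). *)
Definition conv_perm (R : realType) (n : nat) (L : {set 'S_n}) : set 'M[R]_n :=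
  [set x | exists a : 'S_n -> R,
    [/\ forall s, 0 <= a s, \sum_(s in L) a s = 1
      & x = \sum_(s in L) a s *: perm_mx s]].

Definition Birkhoff (R : realType) (n : nat) : set 'M[R]_n :=
  @conv_perm R n [set: 'S_n]%SET.

(* The cones of trop_det, as a subfan of the normal fan of the Birkhoff
   polytope. *)
Definition trop_det_cone (R : realType) (n : nat) (C : set 'M[R]_n) : Prop :=
  normal_fan (@Birkhoff R n) C /\ C `<=` @trop_det R n.

Definition maximal_cone (R : realType) (n : nat) (C : set 'M[R]_n) : Prop :=
  trop_det_cone C /\ forall C', trop_det_cone C' -> C `<=` C' -> C' = C.

Definition positive_cone (R : realType) (n : nat) (C : set 'M[R]_n) : Prop :=
  C `<=` trop (@det_hypersurface R n `&` @positive_orthant R n).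

(** ** The bipartite graph of a cone *)

(* The unique set of permutations whose convex hull is the face dual to C;
   set0 is a dummy value for the C that are not in the normal fan. *)
Definition dual_perms (R : realType) (n : nat) (C : set 'M[R]_n) : {set 'S_n} :=
  xget (finset.set0 : {set 'S_n})
    [set L : {set 'S_n} | dual_to (@Birkhoff R n) (@conv_perm R n L) C].

(* Graphs are given by their edge sets. On the vertex type 'I_n + 'I_n, inl i
   is r_i and inr j is g_j. *)
Definition Gamma (R : realType) (n : nat) (C : set 'M[R]_n) :
    {set {set 'I_n + 'I_n}} :=
  [set [set inl i; inr (s i)] | s : 'S_n in dual_perms C, i : 'I_n in 'I_n]%SET.

Definition cycle_edges (T : finType) (c : seq T) : {set {set T}} :=
  [set [set x; next c x] | x in c]%SET.

Definition perfect_matching (T : finType) (U : {set T}) (M : {set {set T}}) :=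
  finset.partition M U && [forall B in M, #|B| == 2%N].

Definition cycle_and_matching (T : finType) (E : {set {set T}}) (k : nat) :
    Prop :=
  exists c : seq T, exists M : {set {set T}},
    [/\ uniq c, size c = k, (2 < k)%N,
        perfect_matching (~: [set x in c])%SET M
      & E = (cycle_edges c :|: M)%SET].

(* Main.v *)
Require Import Defs.
From mathcomp Require Import all_boot all_order all_fingroup all_algebra.
From mathcomp Require Import complex zify lra ring.
From mathcomp Require Import all_classical all_reals all_analysis.

Set Implicit Arguments.
Unset Strict Implicit.
Unset Printing Implicit Defensive.

Import Order.TTheory GRing.Theory Num.Theory.
Import numFieldNormedType.Exports.

Local Open Scope classical_set_scope.
Local Open Scope ring_scope.

(** Write [weight w s] for the sum of the [w i (s i)]. The face of the Birkhoff
    polytope on which [w] is minimal is the convex hull of [minimisers w], the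
    permutations of least weight, because permutation matrices are its vertices.
    A cone [C] of the normal fan is therefore the set of the [w] at which all the
    permutations of a certain set, [dual_perms C], have least weight.

    If [C] lies in the tropical determinant, this set contains two elements [s != p]:
    near a point with only one minimiser, the determinant has a single term of
    lowest order and cannot vanish. Let [s] and [p] be exchanged along a single
    cycle of the permutation [s^-1 o p]. This splits the sum of their weights into
    those of two new permutations, which are then minimisers as well
    ([cycle_exchange], [exchange_minimisers]). So one may assume that [s] and [p]
    differ by one cycle; then no other permutation is supported on the union of
    their graphs, and they span an edge.

    The cone of such an edge lies in the tropical determinant ([edge_lift]). Near
    any of its points there is a rational matrix [v] whose minimisers are exactly
    [s] and [p]. Put monomials [t^(v i j)] in all entries but one, which occurs in
    the term of [s] and not in that of [p], and solve the vanishing of the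
    determinant, an affine equation, for the last entry. Its leading coefficient
    is minus the product of the signs of [s] and [p]. By maximality [C] is the cone
    of the edge, and its graph is the union of the graphs of [s] and [p]: they
    alternate along a cycle of length [2 * l], where [l] is the length of the cycle
    of [s^-1 o p], and coincide elsewhere.

    The two signs differ exactly when [l] is even, and in that case the matrix
    above is positive. When [l] is odd, near a point of [C] whose only minimisers
    are [s] and [p] the lowest terms of the determinant of a positive matrix all
    have the same sign and cannot cancel. *)

(** * Permutations that differ by one cycle *)

(** As functions this is [s^-1 o p], since products of permutations compose from
    left to right. Its non-fixed points are the points where [s] and [p] differ. *)
Definition transition (T : finType) (s p : {perm T}) : {perm T} := (p * s^-1)%g.

Definition differ_by_cycle (T : finType) (s p : {perm T}) (x0 : T) : Prop :=
  s x0 != p x0 /\ forall x, s x != p x -> x \in porbit (transition s p) x0.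

Lemma transitionE (T : finType) (s p : {perm T}) x : s (transition s p x) = p x.
Proof. by rewrite /transition permM permKV. Qed.

Lemma porbit_step (T : finType) (r : {perm T}) x y :
  (r x \in porbit r y) = (x \in porbit r y).
Proof.
by rewrite -!eq_porbit_mem; have := mem_porbit r 1 x; rewrite expg1 -eq_porbit_mem => /eqP->.
Qed.

(** If [t] takes the value of [p] at a point [x], the value that [s] takes at the
    next point of the cycle is used up, so that [t] must follow [p] there too, and
    hence along the whole cycle. This is why [s] and [p] span an edge of the
    Birkhoff polytope. *)
Lemma differ_by_cycle_vertices (T : finType) (s p t : {perm T}) x0 :
  differ_by_cycle s p x0 -> (forall x, t x = s x \/ t x = p x) -> t = s \/ t = p.
Proof.
move=> [_ cyc] tsp; have [->|nts] := eqVneq t s; [by left|right].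
(* A point where [t] leaves [s] lies on the cycle, which is followed from there. *)
have [x tx] : exists x, t x != s x.
  apply/existsP; apply: contraR nts => /existsPn H; apply/eqP/permP => x.
  by apply/eqP/negPn/H.
have txp : t x = p x by case: (tsp x) => // E; rewrite E eqxx in tx.
have xO : x \in porbit (transition s p) x0 by apply: cyc; rewrite -txp eq_sym.
have along k : t (((transition s p) ^+ k)%g x) = p (((transition s p) ^+ k)%g x).
  elim: k => [|k IH]; first by rewrite expg0 perm1.
  rewrite expgSr permM; set y := (transition s p ^+ k)%g x in IH *.
  case: (tsp (transition s p y)) => // E.
  have yfix : transition s p y = y by apply: (@perm_inj _ t); rewrite E transitionE IH.
  by rewrite yfix.
apply/permP => y; have [spy|spy] := eqVneq (s y) (p y).
  by case: (tsp y) => // ->.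
have := cyc y spy; move: xO; rewrite -eq_porbit_mem => /eqP <- /porbitP[k ->].
exact: along.
Qed.

(** One orbit of [transition s p] is chosen, and [p'] follows [p] on it and [s]
    elsewhere, while [q] does the opposite. Both are injective because [s] and [p]
    have the same image of the orbit. *)
Lemma cycle_exchange (T : finType) (s p : {perm T}) : s != p ->
  exists x0 (p' q : {perm T}), differ_by_cycle s p' x0 /\
    forall x, (p' x = p x /\ q x = s x) \/ (p' x = s x /\ q x = p x).
Proof.
move=> nsp; have [x0 spx] : exists x, s x != p x.
  apply/existsP; apply: contraR nsp => /existsPn H; apply/eqP/permP => x.
  by apply/eqP/negPn/H.
pose O := porbit (transition s p) x0.
have cross x y : x \in O -> y \notin O -> p x != s y.
  move=> xO; apply: contra => /eqP E; have <- : transition s p x = y.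
    by apply: (@perm_inj _ s); rewrite transitionE.
  by rewrite porbit_step.
have cross' x y : x \in O -> y \notin O -> s x != p y.
  move=> xO; apply: contra => /eqP E; rewrite -(porbit_step (transition s p)).
  suff -> : transition s p y = x by [].
  by apply: (@perm_inj _ s); rewrite transitionE.
have inj1 : injective (fun x => if x \in O then p x else s x).
  move=> x y; case: ifPn => xO; case: ifPn => yO; try exact: perm_inj.
    by move/eqP; rewrite (negPf (cross _ _ xO yO)).
  by move/esym/eqP; rewrite (negPf (cross _ _ yO xO)).
have inj2 : injective (fun x => if x \in O then s x else p x).
  move=> x y; case: ifPn => xO; case: ifPn => yO; try exact: perm_inj.
    by move/eqP; rewrite (negPf (cross' _ _ xO yO)).
  by move/esym/eqP; rewrite (negPf (cross' _ _ yO xO)).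
exists x0, (perm inj1), (perm inj2); split; last first.
  by move=> x; rewrite !permE; case: ifP => _; [left|right].
split=> [|x]; first by rewrite permE porbit_id.
rewrite permE; case: ifP; last by rewrite eqxx.
move=> /porbitP[k ->] _; apply/porbitP; exists k; elim: k => [|k IH].
  by rewrite !expg0.
rewrite !expgSr !permM -IH; apply: (@perm_inj _ s); rewrite !permKV permE.
by rewrite mem_porbit.
Qed.

(** The orbits are the given one and singletons, hence their number is
    [#|T| - l + 1], where [l] is the length of the cycle. *)
Lemma odd_perm_cycle (T : finType) (r : {perm T}) x0 :
  (forall x, r x != x -> x \in porbit r x0) ->
  odd_perm r = ~~ odd #|porbit r x0|.
Proof.
move=> cyc; set O := porbit r x0.
have fixO x : x \notin O -> porbit r x = [set x]%SET.
  move=> xO; have rx : r x = x by apply/eqP; apply: contraNT xO => /cyc.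
  apply/setP => y; rewrite inE; apply/porbitP/eqP => [[k ->]|->].
    by elim: k => [|k IH]; rewrite ?expg0 ?perm1// expgSr permM IH.
  by exists 0%N; rewrite expg0 perm1.
have -> : odd_perm r = odd #|T| (+) odd #|porbits r| by [].
have -> : porbits r = (O |: [set [set x] | x in ~: O])%SET.
  apply/setP => B; rewrite !inE; apply/imsetP/orP => [[x _ ->]|[/eqP->|/imsetP[x]]].
  - have [xO|xO] := boolP (x \in O); first by left; rewrite eq_porbit_mem.
    by right; rewrite fixO//; apply/imsetP; exists x; rewrite ?inE.
  - by exists x0.
  - by rewrite inE => xO ->; exists x; rewrite ?fixO.
rewrite cardsU1 card_imset; last exact: set1_inj.
have -> : O \notin [set [set x] | x in ~: O]%SET.
  apply/imsetP => -[x]; rewrite inE => xO E; move: (porbit_id r x0).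
  by rewrite -/O E inE => /eqP xx; move: xO; rewrite -xx porbit_id.
by rewrite -(cardsC O) !oddD /=; do 2 case: odd.
Qed.

Lemma odd_differ_by_cycle (T : finType) (s p : {perm T}) x0 :
  differ_by_cycle s p x0 ->
  (odd_perm s != odd_perm p) = ~~ odd #|porbit (transition s p) x0|.
Proof.
move=> [_ cyc]; rewrite -odd_perm_cycle => [|x].
  by rewrite /transition odd_permM odd_permV; do 2 case: odd_perm.
move=> rx; apply: cyc; apply: contraNneq rx => E.
by apply/eqP/(@perm_inj _ s); rewrite transitionE.
Qed.

Lemma differ_by_cycle_length (T : finType) (s p : {perm T}) x0 :
  differ_by_cycle s p x0 -> (1 < #|porbit (transition s p) x0|)%N.
Proof.
move=> [spx _]; apply/card_gt1P; exists x0, (transition s p x0); split.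
- exact: porbit_id.
- by rewrite porbit_step porbit_id.
- by apply: contra_neq spx => {1}->; rewrite transitionE.
Qed.

(** * The bipartite graph of two such permutations *)

(** Walks along the graph of [p] from left to right and back along the graph of
    [s]. Two steps from a left vertex apply [transition s p]. *)
Definition alternate (T : finType) (s p : {perm T}) (v : T + T) : T + T :=
  match v with inl x => inr (p x) | inr y => inl (s^-1%g y) end.

Lemma alternate_inj (T : finType) (s p : {perm T}) : injective (alternate s p).
Proof. by move=> [x|x] [y|y] //= [] /perm_inj ->. Qed.

Lemma orbit_alternate (T : finType) (s p : {perm T}) x0 v :
  (v \in fingraph.orbit (alternate s p) (inl x0)) =
  match v with
  | inl x => x \in porbit (transition s p) x0
  | inr y => (s^-1)%g y \in porbit (transition s p) x0
  end.
Proof.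
have it k : iter k.*2 (alternate s p) (inl x0) = inl (((transition s p) ^+ k)%g x0).
  elim: k => [|k IH]; first by rewrite expg0 perm1.
  by rewrite doubleS !iterS IH /= expgSr permM /transition permM.
have itS k : iter k.*2.+1 (alternate s p) (inl x0) = inr (p (((transition s p) ^+ k)%g x0)).
  by rewrite iterS it.
have sV y : s^-1%g (p y) = transition s p y by rewrite /transition permM.
rewrite -fconnect_orbit; apply/idP/idP => [/iter_findex <-|].
  set m := findex _ _ _; rewrite -(odd_double_half m); case: (odd m) => /=.
    by rewrite it /= sV porbit_step mem_porbit.
  by rewrite add0n it mem_porbit.
case: v => [x|y].
  by move=> /porbitP[k ->]; rewrite -it fconnect_iter.
move=> yO; have : transition s p (p^-1%g y) \in porbit (transition s p) x0.
  by rewrite /transition permM permKV.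
rewrite porbit_step => /porbitP[k E].
by rewrite -(permKV p y) E -itS fconnect_iter.
Qed.

(** The cycle is the orbit of [inl x0] under [alternate s p], so that the successor
    of a vertex is its image; the matching consists of the common edges of [s] and
    [p] outside of the orbit. *)
Lemma edge_graph (T : finType) (s p : {perm T}) x0 : differ_by_cycle s p x0 ->
  cycle_and_matching
    [set [set inl x; inr (t x)] | t : {perm T} in [set s; p], x : T in T]%SET
    (2 * #|porbit (transition s p) x0|).
Proof.
move=> dsp; set O := porbit (transition s p) x0.
pose c := fingraph.orbit (alternate s p) (inl x0).
pose e (t : {perm T}) (x : T) : {set T + T} := [set inl x; inr (t x)]%SET.
have memc v : v \in c = match v with inl x => x \in O | inr y => (s^-1)%g y \in O end.
  exact: orbit_alternate.
have cU : uniq c by exact: orbit_uniq.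
have nextc v : v \in c -> next c v = alternate s p v.
  by move=> /(next_cycle (cycle_orbit (@alternate_inj _ s p) _))/eqP <-.
have cT : [set v in c]%SET = ([set inl x | x in O] :|: [set inr (s x) | x in O])%SET.
  apply/setP => -[x|y]; rewrite !inE memc.
    rewrite (mem_imset _ _ (@inl_inj _ _)) [X in _ || X](_ : _ = false) ?orbF//.
    by apply/imsetP => -[].
  rewrite [X in X || _](_ : _ = false); last by apply/imsetP => -[].
  apply/idP/imsetP => [yO|[x xO [->]]]; last by rewrite permK.
  by exists (s^-1%g y) => //; rewrite permKV.
have spO x : x \notin O -> s x = p x.
  by move=> xO; apply/eqP; apply: contraNT xO => /(proj2 dsp).
exists c, [set e s x | x in ~: O]%SET; split => //.
- have <- : #|[set v in c]%SET| = size c by rewrite cardsE; exact/card_uniqP.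
  rewrite cT cardsU !card_imset; [|by move=> ? ? [/perm_inj]|by move=> ? ? []].
  rewrite (_ : _ :&: _ = finset.set0)%SET ?cards0 ?subn0 ?mul2n ?addnn//.
  by apply/setP => v; rewrite !inE; apply/andP => -[/imsetP[x _ ->] /imsetP[]].
- by have := differ_by_cycle_length dsp; rewrite -/O; lia.
- have eP v x : v \in e s x = match v with inl y => y == x | inr y => y == s x end.
    by case: v => y; rewrite !inE /eq_op /= ?orbF.
  have tr : finset.trivIset [set e s x | x in ~: O]%SET.
    apply/finset.trivIsetP => _ _ /imsetP[x _ ->] /imsetP[y _ ->] nxy.
    rewrite -setI_eq0; apply/eqP/setP => v; rewrite !(eP, inE).
    apply/negP => /andP[]; case: v => z /eqP-> /eqP.
      by move=> E; rewrite E eqxx in nxy.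
    by move=> /perm_inj E; rewrite E eqxx in nxy.
  apply/andP; split; last first.
    by apply/forallP => B; apply/implyP => /imsetP[x _ ->]; rewrite cards2.
  apply/and3P; split => //; last first.
    apply/imsetP => -[x _ /setP/(_ (inl x))]; by rewrite eP eqxx inE.
  apply/eqP/setP => v; rewrite !inE memc; apply/bigcupP/idP.
    move=> [_ /imsetP[x xO ->]]; rewrite eP; move: xO; rewrite inE.
    by case: v => y xO /eqP->; rewrite ?permK.
  case: v => y yO.
    by exists (e s y); rewrite ?eP// imset_f// inE.
  exists (e s (s^-1%g y)); last by rewrite eP permKV.
  by rewrite imset_f// inE.
apply/setP => B; apply/imset2P/setUP.
- move=> [t x]; rewrite !inE => tsp _ ->; rewrite -/(e t x).
  have [xO|xO] := boolP (x \in O); last first.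
    right; apply/imsetP; exists x; rewrite ?inE//.
    by case/orP: tsp => /eqP-> //; rewrite /e spO.
  left; apply/imsetP; case/orP: tsp => /eqP->.
    exists (inr (s x)); first by rewrite memc permK.
    rewrite nextc ?memc ?permK//= permK; exact: finset.setUC.
  by exists (inl x); rewrite ?nextc ?memc.
- case=> /imsetP[].
    move=> [x|y]; rewrite memc => vO ->; rewrite nextc ?memc//=.
      by exists p x; rewrite ?inE ?eqxx ?orbT.
    exists s (s^-1%g y); rewrite ?inE ?eqxx// permKV; exact: finset.setUC.
  by move=> x _ ->; exists s x; rewrite ?inE ?eqxx.
Qed.

(** * Leading terms of Puiseux series *)

(** The coefficient [a] may be zero. This makes the notion stable under sums in which
    leading terms cancel, and [0] starts at every exponent. *)
Definition starts_at (R : realType) (f : puiseux R) (q : rat) (a : R[i]) : Prop :=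
  (forall r, r < q -> f r = 0) /\ f q = a.

Lemma starts_at0 (R : realType) q : starts_at (0 : puiseux R) q 0.
Proof. by []. Qed.

Lemma starts_at1 (R : realType) : starts_at (1 : puiseux R) 0 1.
Proof.
by split=> [r r0|]; rewrite /= /puiseux_one_fun ?eqxx// lt_eqF.
Qed.

Lemma starts_atN (R : realType) (f : puiseux R) q a :
  starts_at f q a -> starts_at (- f) q (- a).
Proof.
move=> [f0 fq]; split=> [r rq|].
  by rewrite -[LHS]/(- f r) f0// oppr0.
by rewrite -[LHS]/(- f q) fq.
Qed.

Lemma starts_atD (R : realType) (f g : puiseux R) q a b :
  starts_at f q a -> starts_at g q b -> starts_at (f + g) q (a + b).
Proof.
move=> [f0 fq] [g0 gq]; split=> [r rq|].
  by rewrite -[LHS]/(f r + g r) f0// g0// addr0.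
by rewrite -[LHS]/(f q + g q) fq gq.
Qed.

Lemma starts_at_sum (R : realType) (I : finType) (f : I -> puiseux R) q (a : I -> R[i]) :
  (forall i, starts_at (f i) q (a i)) -> starts_at (\sum_i f i) q (\sum_i a i).
Proof.
move=> fa; apply: (big_ind2 (fun f a => starts_at f q a)) => //.
by move=> *; exact: starts_atD.
Qed.

(** At the exponent [q + r] the only contribution to the Cauchy product comes from
    the coefficients at [q] and [r]. *)
Lemma starts_atM (R : realType) (f g : puiseux R) q r a b :
  starts_at f q a -> starts_at g r b -> starts_at (f * g) (q + r) (a * b).
Proof.
move=> [f0 fq] [g0 gr]; split=> [u uqr|].
  rewrite -[LHS]/(puiseux_mul_fun f g u); apply: fsbig1 => x _.
  have [xq|qx] := ltP x q; first by rewrite f0// mul0r.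
  by rewrite g0 ?mulr0//; lra.
rewrite -[LHS]/(puiseux_mul_fun f g (q + r)) /puiseux_mul_fun.
rewrite (fsbigE [:: q])//; last first.
  move=> x _; rewrite inE; case: ltgtP => // [xq|qx] _.
    by rewrite f0// mul0r.
  by rewrite g0 ?mulr0//; lra.
rewrite (eq_bigl xpredT); last by move=> i; rewrite in_setT.
by rewrite big_seq1 fq addrAC subrr add0r gr.
Qed.

Lemma starts_at_prod (R : realType) (I : finType) (f : I -> puiseux R)
    (q : I -> rat) (a : I -> R[i]) :
  (forall i, starts_at (f i) (q i) (a i)) ->
  starts_at (\prod_i f i) (\sum_i q i) (\prod_i a i).
Proof.
move=> fa; suff : forall s : seq I,
    starts_at (\prod_(i <- s) f i) (\sum_(i <- s) q i) (\prod_(i <- s) a i) by apply.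
elim=> [|i s IH]; first by rewrite !big_nil; exact: starts_at1.
by rewrite !big_cons; exact: starts_atM.
Qed.

Lemma starts_at_sign (R : realType) (f : puiseux R) q a (b : bool) :
  starts_at f q a -> starts_at ((-1) ^+ b * f) q ((-1) ^+ b * a).
Proof.
by case: b; rewrite ?expr1 ?expr0 ?mulN1r ?mul1r//; exact: starts_atN.
Qed.

Lemma starts_at_lt (R : realType) (f : puiseux R) q r a :
  starts_at f r a -> q < r -> starts_at f q 0.
Proof.
by move=> [f0 _] qr; split=> [u uq|]; apply: f0 => //; exact: lt_trans qr.
Qed.

Lemma starts_at_neq0 (R : realType) (f : puiseux R) q a :
  starts_at f q a -> a != 0 -> f != 0.
Proof. by move=> [_ <-]; apply: contra_neq => ->. Qed.

Lemma starts_at_val (R : realType) (f : puiseux R) q a :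
  starts_at f q a -> a != 0 -> puiseux_val f = q /\ puiseux_lc f = a.
Proof.
move=> fa a0; have := fa => -[f0 fq].
have [fv vmin] := puiseux_valP (starts_at_neq0 fa a0).
suff vq : puiseux_val f = q by rewrite /puiseux_lc vq.
apply/le_anti/andP; split; first by apply: vmin; rewrite fq.
by rewrite leNgt; apply: contraNN fv => /f0 ->.
Qed.

Lemma starts_at_lc (R : realType) (f : puiseux R) : f != 0 ->
  puiseux_lc f != 0 /\ starts_at f (puiseux_val f) (puiseux_lc f).
Proof.
move=> /puiseux_valP[f0 fmin]; split=> //; split=> // r rv.
by apply/eqP; apply: contraTT rv => /fmin; rewrite leNgt.
Qed.

Lemma starts_atV (R : realType) (f : puiseux R) q a :
  starts_at f q a -> a != 0 -> starts_at f^-1 (- q) a^-1.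
Proof.
move=> fa a0; have f0 := starts_at_neq0 fa a0.
have [b0 gb] : puiseux_lc f^-1 != 0 /\
    starts_at f^-1 (puiseux_val f^-1) (puiseux_lc f^-1).
  by apply: starts_at_lc; rewrite invr_eq0.
have := starts_atM fa gb; rewrite divff// => /starts_at_val.
rewrite mulf_neq0// => /(_ isT)[].
have [-> ->] := starts_at_val (starts_at1 R) (oner_neq0 _) => v l.
have -> : - q = puiseux_val f^-1 by lra.
suff -> : a^-1 = puiseux_lc f^-1 by [].
by apply: (mulfI a0); rewrite divff.
Qed.

Lemma monomial_puiseux (R : realType) (q : rat) :
  (fun r : rat => (r == q)%:R : R[i]) \in @is_puiseux R.
Proof.
apply/puiseuxP; exists `|denq q|%N, (numq q); split=> [|r].
  by rewrite absz_gt0 denq_neq0.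
have [->|_] := eqVneq r q; last by rewrite eqxx.
move=> _; exists 0%N; rewrite /puiseux_pt addr0 -[LHS]divq_num_den.
by rewrite -[X in _ = _ / X]/((Posz `|denq q|%N)%:~R) absz_denq.
Qed.

Definition monomial (R : realType) (q : rat) : puiseux R :=
  Puiseux (monomial_puiseux R q).

Lemma starts_at_monomial (R : realType) q : starts_at (monomial R q) q 1.
Proof. by split=> [r rq|] /=; rewrite ?eqxx// lt_eqF. Qed.

(** * Weights of permutations *)

Definition weight (F : realDomainType) (n : nat) (w : 'M[F]_n) (s : 'S_n) : F :=
  \sum_i w i (s i).

Definition minimisers (F : realDomainType) (n : nat) (w : 'M[F]_n) : {set 'S_n} :=
  [set s | [forall t, weight w s <= weight w t]]%SET.

Lemma minimisersP (F : realDomainType) (n : nat) (w : 'M[F]_n) (s : 'S_n) :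
  reflect (forall t, weight w s <= weight w t) (s \in minimisers w).
Proof. by rewrite inE; exact: forallP. Qed.

Lemma minimisers_neq0 (F : realDomainType) (n : nat) (w : 'M[F]_n) :
  exists s, s \in minimisers w.
Proof.
case: (@arg_minP _ _ _ 1%g xpredT (weight w) isT) => s _ smin.
by exists s; apply/minimisersP => t; exact: smin.
Qed.

Lemma minimisers_eq (F : realDomainType) (n : nat) (w : 'M[F]_n) (s t : 'S_n) :
  s \in minimisers w -> (t \in minimisers w) = (weight w t == weight w s).
Proof.
move=> /minimisersP smin; apply/minimisersP/eqP => [tmin|-> //].
by apply/le_anti; rewrite smin tmin.
Qed.

Lemma weight_map (R : realType) (n : nat) (v : 'M[rat]_n) (s : 'S_n) :
  weight (map_mx (ratr : rat -> R) v) s = ratr (weight v s).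
Proof. by rewrite /weight rmorph_sum; apply: eq_bigr => i _; rewrite mxE. Qed.

Lemma minimisers_map (R : realType) (n : nat) (v : 'M[rat]_n) :
  minimisers (map_mx (ratr : rat -> R) v) = minimisers v.
Proof.
apply/setP => s; apply/minimisersP/minimisersP => smin t; have := smin t.
  by rewrite !weight_map ler_rat.
by rewrite !weight_map ler_rat.
Qed.

(** * Leading term of a determinant *)

(** Only the terms of the minimisers contribute at the least weight. The matrix [c]
    may have zero entries, which kills some of these terms. *)
Lemma starts_at_det (R : realType) (n : nat) (z : 'M[puiseux R]_n) (v : 'M[rat]_n)
    (c : 'M[R[i]]_n) (s0 : 'S_n) :
  (forall i j, starts_at (z i j) (v i j) (c i j)) -> s0 \in minimisers v ->
  starts_at (\det z) (weight v s0)
    (\sum_(s in minimisers v) (-1) ^+ s * \prod_i c i (s i)).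
Proof.
move=> zc s0min; rewrite big_mkcond; apply: starts_at_sum => s.
have zs := starts_at_sign (odd_perm s) (starts_at_prod (fun i => zc i (s i))).
rewrite (minimisers_eq _ s0min); case: eqP => [<-//|/eqP ws].
apply: starts_at_lt zs _; rewrite lt_neqAle eq_sym ws.
exact: (minimisersP _ _ s0min).
Qed.

(** The entry at [(i0, s i0)] is an unknown [x] times a monomial. The determinant
    is [x * \det B + \det D], where [s] gives the leading term of [\det B] and [p] that
    of [\det D]. So the solution [x] starts at exponent [0] with coefficient minus
    the product of the signs of [s] and [p]. *)
Lemma zero_det_lift (R : realType) (n : nat) (v : 'M[rat]_n) (s p : 'S_n) (i0 : 'I_n) :
  s i0 != p i0 -> minimisers v = [set s; p]%SET ->
  exists z : 'M[puiseux R]_n, \det z = 0 /\ forall i j,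
    starts_at (z i j) (v i j)
      (if (i == i0) && (j == s i0) && (odd_perm s == odd_perm p) then -1 else 1).
Proof.
move=> spi0 vsp.
have smin : s \in minimisers v by rewrite vsp !inE eqxx.
(* [B] is the coefficient of the unknown in the expansion along row [i0], and [D] is
   the constant part. *)
pose B : 'M[puiseux R]_n := \matrix_(i, j)
  if (i == i0) && (j != s i0) then 0 else monomial R (v i j).
pose D : 'M[puiseux R]_n := \matrix_(i, j)
  if (i == i0) && (j == s i0) then 0 else monomial R (v i j).
pose b : 'M[R[i]]_n := \matrix_(i, j) if (i == i0) && (j != s i0) then 0 else 1.
pose d : 'M[R[i]]_n := \matrix_(i, j) if (i == i0) && (j == s i0) then 0 else 1.
have Bb i j : starts_at (B i j) (v i j) (b i j).
  by rewrite !mxE; case: ifP => _; [exact: starts_at0|exact: starts_at_monomial].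
have Dd i j : starts_at (D i j) (v i j) (d i j).
  by rewrite !mxE; case: ifP => _; [exact: starts_at0|exact: starts_at_monomial].
have sp : s != p by apply: contraNneq spi0 => ->.
have two (c : 'M[R[i]]_n) : \sum_(t in minimisers v) (-1) ^+ t * \prod_i c i (t i) =
    (-1) ^+ s * \prod_i c i (s i) + (-1) ^+ p * \prod_i c i (p i).
  by rewrite vsp big_setU1 ?inE//= big_set1.
have detB : starts_at (\det B) (weight v s) ((-1) ^+ s).
  have := starts_at_det Bb smin; rewrite two.
  rewrite big1 => [|i _]; last by rewrite mxE; case: eqP => [->|]//; rewrite eqxx.
  rewrite [X in _ + _ * X](bigD1 i0)//= mxE eqxx eq_sym spi0 /= mul0r.
  by rewrite mulr1 mulr0 addr0.
have detD : starts_at (\det D) (weight v s) ((-1) ^+ p).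
  have := starts_at_det Dd smin; rewrite two.
  rewrite (bigD1 i0)//= mxE !eqxx /= mul0r mulr0 add0r.
  rewrite big1 ?mulr1// => i _; rewrite mxE.
  by have [->|]//= := eqVneq i i0; rewrite eq_sym (negPf spi0).
have sgn0 : ((-1) ^+ s : R[i]) != 0 by rewrite signr_eq0.
pose x := - \det D / \det B.
have xE : starts_at x 0 (if odd_perm s == odd_perm p then -1 else 1).
  have := starts_atM (starts_atN detD) (starts_atV detB sgn0).
  rewrite subrr => xx; rewrite (_ : (if _ then _ else _) = - (-1) ^+ p / (-1) ^+ s)//.
  by case: (odd_perm s); case: (odd_perm p); rewrite /= ?expr1 ?expr0 ?opprK; field.
pose z : 'M[puiseux R]_n := \matrix_(i, j)
  if (i == i0) && (j == s i0) then x * monomial R (v i j) else monomial R (v i j).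
exists z; split=> [|i j]; last first.
  rewrite mxE; case: ifP => _ /=; last exact: starts_at_monomial.
  rewrite -[v i j]add0r -[if _ then _ else _]mulr1.
  by apply: starts_atM => //; rewrite add0r; exact: starts_at_monomial.
rewrite (@determinant_multilinear _ _ z B D i0 x 1).
- by rewrite /x divfK ?(starts_at_neq0 detB)// mul1r addNr.
- apply/rowP => j; rewrite !mxE eqxx /=.
  by case: ifP => /= _; rewrite ?mulr0 ?mul1r ?addr0 ?add0r.
- by apply/matrixP => i j; rewrite !mxE eq_sym (negPf (neq_lift _ _)).
- by apply/matrixP => i j; rewrite !mxE eq_sym (negPf (neq_lift _ _)).
Qed.

Lemma val_mx_map (R : realType) (n : nat) (z : 'M[puiseux R]_n) :
  val_mx z = map_mx ratr (\matrix_(i, j) puiseux_val (z i j)).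
Proof. by apply/matrixP => i j; rewrite !mxE. Qed.

Lemma det_neq0 (R : realType) (n : nat) (z : 'M[puiseux R]_n) : torus z ->
  \sum_(s in minimisers (val_mx z)) (-1) ^+ s * \prod_i puiseux_lc (z i (s i)) != 0 ->
  \det z != 0.
Proof.
move=> z0; rewrite val_mx_map minimisers_map.
pose v := \matrix_(i, j) puiseux_val (z i j); pose c := \matrix_(i, j) puiseux_lc (z i j).
have zc i j : starts_at (z i j) (v i j) (c i j).
  by rewrite !mxE; case: (starts_at_lc (z0 i j)).
have [s0 s0min] := minimisers_neq0 v; have := starts_at_det zc s0min.
rewrite (eq_bigr (fun s => (-1) ^+ odd_perm s * \prod_i puiseux_lc (z i (s i)))).
  exact: starts_at_neq0.
by move=> s _; congr (_ * _); apply: eq_bigr => i _; rewrite mxE.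
Qed.

Lemma det_neq0_single (R : realType) (n : nat) (z : 'M[puiseux R]_n) (s : 'S_n) :
  torus z -> minimisers (val_mx z) = [set s]%SET -> \det z != 0.
Proof.
move=> z0 zs; apply: det_neq0 => //; rewrite zs big_set1 mulf_neq0 ?signr_eq0//.
by apply/prodf_neq0 => i _; case: (starts_at_lc (z0 i (s i))).
Qed.

Lemma det_neq0_positive (R : realType) (n : nat) (z : 'M[puiseux R]_n) (b : bool) :
  torus z -> positive_orthant z ->
  (forall s, s \in minimisers (val_mx z) -> odd_perm s = b) -> \det z != 0.
Proof.
move=> z0 zpos zb; apply: det_neq0 => //.
rewrite (eq_bigr (fun s : 'S_n => (-1) ^+ b * \prod_i puiseux_lc (z i (s i)))); last first.
  by move=> s /zb ->.
rewrite -mulr_sumr mulf_neq0 ?signr_eq0//.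
have [s smin] := minimisers_neq0 (val_mx z).
have lcs t : 0 < \prod_i puiseux_lc (z i (t i)) by apply: prodr_gt0 => i _; exact: zpos.
rewrite gt_eqF// (bigD1 s)//= ltr_pwDl// sumr_ge0// => t _; exact: ltW.
Qed.

(** * Faces of the Birkhoff polytope *)

Lemma mx_dot_perm_sum (R : realType) (n : nat) (w : 'M[R]_n) (L : {set 'S_n})
    (a : 'S_n -> R) :
  mx_dot w (\sum_(s in L) a s *: perm_mx s) = \sum_(s in L) a s * weight w s.
Proof.
rewrite /mx_dot (eq_bigr (fun i => \sum_(s in L) a s * w i (s i))) => [|i _].
  by rewrite exchange_big; apply: eq_bigr => s _; rewrite mulr_sumr.
rewrite (eq_bigr (fun j => \sum_(s in L) a s * (w i j * (s i == j)%:R))) => [|j _].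
  rewrite exchange_big; apply: eq_bigr => s _; rewrite -mulr_sumr; congr (_ * _).
  rewrite (bigD1 (s i))//= eqxx mulr1 big1 ?addr0// => j.
  by rewrite eq_sym => /negPf ->; rewrite mulr0.
rewrite summxE mulr_sumr; apply: eq_bigr => s _.
by rewrite !mxE mulrCA.
Qed.

Lemma conv_perm_vertex (R : realType) (n : nat) (L : {set 'S_n}) (s : 'S_n) :
  s \in L -> @conv_perm R n L (perm_mx s).
Proof.
move=> sL; exists (fun t => (t == s)%:R); split=> [t| |]; first exact: ler0n.
- rewrite (bigD1 s)//= eqxx big1 ?addr0// => t /andP[_ /negPf ->] //.
- rewrite (bigD1 s)//= eqxx scale1r big1 ?addr0// => t /andP[_ /negPf ->].
  by rewrite scale0r.
Qed.

Lemma mx_dot_perm (R : realType) (n : nat) (w : 'M[R]_n) (s : 'S_n) :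
  mx_dot w (perm_mx s) = weight w s.
Proof.
have := mx_dot_perm_sum w [set s]%SET (fun=> 1).
by rewrite !big_set1 scale1r mul1r.
Qed.

Lemma conv_permS (R : realType) (n : nat) (L L' : {set 'S_n}) :
  L \subset L' -> @conv_perm R n L `<=` conv_perm L'.
Proof.
move=> LL x [a [a0 a1 ->]]; exists (fun s => if s \in L then a s else 0); split.
- by move=> s; case: ifP.
- rewrite -big_mkcondr -[RHS]a1; apply: eq_bigl => s.
  by case: (boolP (s \in L)) => [/(fintype.subsetP LL)->|]; rewrite ?andbF.
- rewrite [RHS](eq_bigr (fun s => if s \in L then a s *: perm_mx s else 0)); last first.
    by move=> s _; case: ifP; rewrite ?scale0r.
  rewrite -big_mkcondr; apply: eq_bigl => s.
  by case: (boolP (s \in L)) => [/(fintype.subsetP LL)->|]; rewrite ?andbF.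
Qed.

(** A permutation [t] other than [s] has a one where [perm_mx s] has a zero, and no
    cancellation is possible in a sum with nonnegative coefficients. *)
Lemma conv_perm_mem (R : realType) (n : nat) (L : {set 'S_n}) (s : 'S_n) :
  @conv_perm R n L (perm_mx s) -> s \in L.
Proof.
move=> [a [a0 a1 sa]]; apply/negPn/negP => sL.
suff : \sum_(t in L) a t = 0 by rewrite a1 => /eqP; rewrite oner_eq0.
apply: big1 => t tL.
have [i sti] : exists i, s i != t i.
  apply/existsP; rewrite -negb_forall; apply: contra sL => /forallP st.
  by rewrite (_ : s = t)//; apply/permP => i; apply/eqP/st.
have /matrixP/(_ i (t i)) := sa; rewrite summxE !mxE (negPf sti) => /esym.
move=> /psumr_eq0P sum0; have := sum0 _ t tL.
rewrite !mxE eqxx mulr1; apply => u _; rewrite !mxE mulr_ge0//.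
Qed.

(** The value of [w] at a convex combination is the average of the weights, which is
    minimal only if permutations of larger weight get coefficient zero. *)
Lemma min_face_Birkhoff (R : realType) (n : nat) (w : 'M[R]_n) :
  min_face (@Birkhoff R n) w = conv_perm (minimisers w).
Proof.
have [s0 s0min] := minimisers_neq0 w; have /minimisersP s0le := s0min.
have ge y : @Birkhoff R n y -> weight w s0 <= mx_dot w y.
  move=> [a [a0 a1 ->]]; rewrite mx_dot_perm_sum.
  rewrite -[leLHS]mul1r -a1 mulr_suml; apply: ler_sum => s _.
  exact: ler_wpM2l.
apply/seteqP; split=> [x [[a [a0 a1 xa]] xmin]|x xc]; last first.
  split=> [|y /ge]; first exact: conv_permS (finset.subsetT _) _ xc.
  apply: le_trans; case: xc => a [a0 a1 ->]; rewrite mx_dot_perm_sum.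
  rewrite -[leRHS]mul1r -a1 mulr_suml; apply: ler_sum => s.
  by rewrite (minimisers_eq _ s0min) => /eqP ->.
have : mx_dot w x <= weight w s0.
  by rewrite -mx_dot_perm; apply: xmin; apply: conv_perm_vertex; rewrite inE.
rewrite xa mx_dot_perm_sum => xle.
have a_out s : s \notin minimisers w -> a s = 0.
  move=> sw; have gap t : 0 <= a t * (weight w t - weight w s0).
    by rewrite mulr_ge0// subr_ge0.
  have sum0 : \sum_(t in [set: 'S_n]%SET) a t * (weight w t - weight w s0) = 0.
    apply/le_anti/andP; split; last exact: sumr_ge0.
    under eq_bigr do rewrite mulrBr.
    by rewrite sumrB -mulr_suml a1 mul1r subr_le0.
  have /eqP := psumr_eq0P (fun t _ => gap t) sum0 (finset.in_setT s).
  rewrite mulf_eq0 subr_eq0 -(minimisers_eq _ s0min) (negPf sw) orbF.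
  exact: eqP.
have sub (V : nmodType) (F : 'S_n -> V) : (forall s, a s = 0 -> F s = 0) ->
    \sum_(s in [set: 'S_n]%SET) F s = \sum_(s in minimisers w) F s.
  move=> F0; rewrite [RHS]big_mkcond; apply: eq_big => s; rewrite ?finset.in_setT// => _.
  by case: ifPn => // sw; rewrite F0 ?a_out.
exists a; split=> //.
- by rewrite -sub.
- by rewrite sub// => s ->; rewrite scale0r.
Qed.

Lemma normal_cone_conv (R : realType) (n : nat) (L : {set 'S_n}) :
  normal_cone (@Birkhoff R n) (conv_perm L) = [set w | L \subset minimisers w].
Proof.
apply/seteqP; split=> w; rewrite /normal_cone /= min_face_Birkhoff.
  by move=> sub; apply/fintype.subsetP => s sL; apply/conv_perm_mem/sub/conv_perm_vertex.
exact: conv_permS.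
Qed.

Lemma normal_fan_minimisers (R : realType) (n : nat) (w : 'M[R]_n) :
  dual_to (@Birkhoff R n) (conv_perm (minimisers w))
    [set w' | minimisers w \subset minimisers w'].
Proof.
split; last by rewrite normal_cone_conv.
split; last by exists w; rewrite min_face_Birkhoff.
by have [s smin] := minimisers_neq0 w; exists (perm_mx s); exact: conv_perm_vertex.
Qed.

(** The dummy value in the choice of [dual_perms C] never occurs, since the face dual
    to [C] is spanned by the minimisers of some [w]. *)
Lemma dual_permsP (R : realType) (n : nat) (C : set 'M[R]_n) :
  normal_fan (@Birkhoff R n) C ->
  (exists w : 'M[R]_n, dual_perms C = minimisers w) /\
  C = [set w | dual_perms C \subset minimisers w].
Proof.
move=> [_ [[_ [w ->]] CE]].
have : exists L : {set 'S_n}, dual_to (@Birkhoff R n) (conv_perm L) C.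
  exists (minimisers w); rewrite CE min_face_Birkhoff normal_cone_conv.
  exact: normal_fan_minimisers.
move=> /(@xgetPex _ (finset.set0 : {set 'S_n}) [set L | dual_to (@Birkhoff R n) (conv_perm L) C]).
rewrite -/(dual_perms C) /= => -[[_ [u Lu]] CL]; split; last first.
  by rewrite {1}CL normal_cone_conv.
exists u; move: Lu; rewrite min_face_Birkhoff => Lu.
apply/setP => s; apply/idP/idP => sL; apply: (@conv_perm_mem R).
  by rewrite -Lu; exact: conv_perm_vertex.
by rewrite Lu; exact: conv_perm_vertex.
Qed.

(** * Edges of the Birkhoff polytope *)

(** A generic point of the cone dual to the edge spanned by [s] and [p]. *)
Definition edge_weight (R : realType) (n : nat) (s p : 'S_n) : 'M[R]_n :=
  \matrix_(i, j) (~~ ((s i == j) || (p i == j)))%:R.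

(** Any point of the cone of an edge is a limit of points in its relative
    interior. *)
Lemma minimisers_add_edge_weight (R : realType) (n : nat) (s p : 'S_n) (i0 : 'I_n)
    (w : 'M[R]_n) (e : R) :
  differ_by_cycle s p i0 -> s \in minimisers w -> p \in minimisers w -> 0 < e ->
  minimisers (w + e *: edge_weight R s p) = [set s; p]%SET.
Proof.
move=> dsp smin pmin e0; set w1 := edge_weight R s p.
have wE t : weight (w + e *: w1) t = weight w t + e * weight w1 t.
  rewrite /weight mulr_sumr -big_split; apply: eq_bigr => i _.
  by rewrite !mxE.
have w1_ge0 t i : 0 <= w1 i (t i) by rewrite mxE ler0n.
have w1s : weight w1 s = 0 by rewrite /weight big1// => i _; rewrite mxE eqxx.
have w1p : weight w1 p = 0 by rewrite /weight big1// => i _; rewrite mxE eqxx orbT.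
have sM : s \in minimisers (w + e *: w1).
  apply/minimisersP => t; rewrite !wE w1s mulr0 lerD//.
    exact: (minimisersP _ _ smin).
  by rewrite mulr_ge0 ?(ltW e0)// sumr_ge0.
have wps : weight w p = weight w s by apply/eqP; rewrite -minimisers_eq.
apply/setP => t; rewrite (minimisers_eq _ sM) !wE w1s mulr0 addr0 !inE.
apply/eqP/orP => [wt|[]/eqP->]; last 2 first.
- by rewrite w1s mulr0 addr0.
- by rewrite w1p mulr0 addr0.
have ts : weight w s <= weight w t by exact: (minimisersP _ _ smin).
have w1t : weight w1 t = 0.
  apply/eqP; have : e * weight w1 t <= 0 by lra.
  rewrite pmulr_rle0// => t0; apply/eqP/le_anti; rewrite t0.
  exact: sumr_ge0.
suff [->|->] : t = s \/ t = p by [left|right].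
apply: (differ_by_cycle_vertices dsp) => i.
have /psumr_eq0P/(_ w1t) H : forall i, xpredT i -> 0 <= w1 i (t i) by [].
have := H i isT; rewrite mxE => /eqP; rewrite pnatr_eq0 eqb0 negbK.
by case/orP => /eqP <-; [left|right].
Qed.

(** The weights of [p'] and [q] add up to twice the least weight. *)
Lemma exchange_minimisers (F : realDomainType) (n : nat) (w : 'M[F]_n)
    (s p p' q : 'S_n) :
  s \in minimisers w -> p \in minimisers w ->
  (forall i, (p' i = p i /\ q i = s i) \/ (p' i = s i /\ q i = p i)) ->
  p' \in minimisers w.
Proof.
move=> smin pmin ex; rewrite (minimisers_eq _ smin).
have wps : weight w p = weight w s by apply/eqP; rewrite -minimisers_eq.
have : weight w p' + weight w q = weight w s + weight w p.
  rewrite /weight -!big_split; apply: eq_bigr => i _ /=.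
  by case: (ex i) => -[-> ->]; rewrite // addrC.
rewrite wps => sum; apply/eqP/le_anti; rewrite (minimisersP _ _ smin p') andbT.
by rewrite -(lerD2r (weight w q)) sum lerD2l; exact: (minimisersP _ _ smin).
Qed.

(** * Approximation by rational matrices *)

Lemma continuous_weight (R : realType) (n : nat) (s : 'S_n) :
  continuous (fun w : 'M[R]_n => weight w s).
Proof.
apply: (continuous_big (add_continuous (s := R))) => i _.
exact: coord_continuous.
Qed.

Lemma continuous_mx (R : realType) (m n : nat) (T : topologicalType)
    (f : T -> 'M[R]_(m, n)) :
  (forall i j, continuous (fun x => f x i j)) -> continuous f.
Proof.
move=> fc x A [P fP PA]; rewrite /nbhs /=.
suff : \forall y \near x, forall i j, P i j (f y i j).
  by apply: filterS => y Py; apply: PA => i j; exact: Py.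
apply: filter_forall => i; apply: filter_forall => j.
exact: (fc i j x _ (fP i j)).
Qed.

Lemma near_forall_lt (R : realType) (T : topologicalType) (I : finType) (P : pred I)
    (f : T -> R) (g : I -> T -> R) (x : T) :
  continuous f -> (forall i, continuous (g i)) -> (forall i, P i -> f x < g i x) ->
  nbhs x [set y | forall i, P i -> f y < g i y].
Proof.
move=> fc gc fg; have lt_near i : P i -> nbhs x [set y | f y < g i y].
  move=> Pi; have gap : 0 < g i x - f x by rewrite subr_gt0 fg.
  have cts : (g i y - f y) @[y --> x] --> g i x - f x.
    by apply: cvgB; [exact: gc|exact: fc].
  by apply: filterS (cvgr_gt _ cts _ gap) => y /=; rewrite subr_gt0.
apply: filter_forall => i; have [Pi|Pi] := boolP (P i); last exact: nearW.
by apply: filterS (lt_near i Pi).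
Qed.

(** The finitely many strict inequalities that exclude a permutation from the
    minimisers are open conditions. *)
Lemma minimisers_near (R : realType) (n : nat) (w : 'M[R]_n) :
  nbhs w [set u : 'M[R]_n | minimisers u \subset minimisers w].
Proof.
have [s smin] := minimisers_neq0 w; have /minimisersP sle := smin.
have : nbhs w [set u : 'M[R]_n | forall t, t \notin minimisers w -> weight u s < weight u t].
  apply: near_forall_lt => [|t|t tw]; try exact: continuous_weight.
  by rewrite lt_neqAle sle eq_sym -(minimisers_eq _ smin) tw.
apply: (@filterS _ (nbhs w) (nbhs_filter w)) => u ut.
apply/fintype.subsetP => t /minimisersP tmin.
by apply: contraT => /ut; rewrite ltNge tmin.
Qed.

Lemma dense_rat_mx (R : realType) (m n : nat) (u : 'M[R]_(m, n)) (A : set 'M[R]_(m, n)) :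
  nbhs u A -> exists v : 'M[rat]_(m, n), A (map_mx ratr v).
Proof.
move=> [P uP PA].
have /fin_all_exists[v vP] : forall i, exists vi : 'I_n -> rat, forall j, P i j (ratr (vi j)).
  move=> i; apply: (@fin_all_exists _ _ (fun j (q : rat) => P i j (ratr q))) => j.
  have Pn : (P i j)° !=set0 by exists (u i j); exact: uP.
  have [r [Pr [q _ qE]]] := dense_rat Pn (@open_interior _ _).
  by exists q; apply: interior_subset; rewrite qE.
by exists (\matrix_(i, j) v i j); apply: PA => i j; rewrite !mxE.
Qed.

(** Only the entry at [(i0, s i0)] is changed, so that [s] gets the weight of [p].
    The construction commutes with the embedding of the rationals, is continuous over
    the reals, and fixes the matrices at which the weights already agree; so it turns
    rational approximations of such a matrix into rational approximations that satisfy
    the equality. *)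
Definition equalise (F : realDomainType) (n : nat) (s p : 'S_n) (i0 : 'I_n) (u : 'M[F]_n) :
    'M[F]_n :=
  \matrix_(i, j) if (i == i0) && (j == s i0)
    then weight u p - \sum_(k | k != i0) u k (s k) else u i j.

Lemma equalise_weight (F : realDomainType) (n : nat) (s p : 'S_n) i0 (u : 'M[F]_n) :
  s i0 != p i0 -> weight (equalise s p i0 u) s = weight (equalise s p i0 u) p.
Proof.
move=> sp; transitivity (weight u p).
  rewrite /weight (bigD1 i0)//= mxE !eqxx /= -[RHS](subrK (\sum_(k | k != i0) u k (s k))).
  by congr (_ + _); apply: eq_bigr => k /negPf k0; rewrite mxE k0.
apply: eq_bigr => k _; rewrite mxE.
by have [->|]//= := eqVneq k i0; rewrite eq_sym (negPf sp).
Qed.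

Lemma equalise_id (F : realDomainType) (n : nat) (s p : 'S_n) i0 (u : 'M[F]_n) :
  weight u s = weight u p -> equalise s p i0 u = u.
Proof.
move=> usp; apply/matrixP => i j; rewrite mxE -usp /weight (bigD1 i0)//= addrK.
by case: ifP => // /andP[/eqP-> /eqP->].
Qed.

Lemma equalise_map (R : realType) (n : nat) (s p : 'S_n) i0 (v : 'M[rat]_n) :
  equalise s p i0 (map_mx (ratr : rat -> R) v) = map_mx ratr (equalise s p i0 v).
Proof.
apply/matrixP => i j; rewrite !mxE; case: ifP => // _.
rewrite weight_map rmorphB; congr (_ - _); rewrite rmorph_sum.
by apply: eq_bigr => k _; rewrite mxE.
Qed.

Lemma continuous_equalise (R : realType) (n : nat) (s p : 'S_n) i0 :
  continuous (@equalise R n s p i0).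
Proof.
apply: continuous_mx => i j.
have -> : (fun u : 'M[R]_n => @equalise R n s p i0 u i j) = fun u : 'M[R]_n =>
    if (i == i0) && (j == s i0) then weight u p - \sum_(k | k != i0) u k (s k) else u i j.
  by apply/funext => u; rewrite mxE.
case: ((i == i0) && (j == s i0)); last exact: coord_continuous.
have sum_cts : continuous (fun u : 'M[R]_n => \sum_(k | k != i0) u k (s k)).
  by apply: (continuous_big (add_continuous (s := R))) => k _; exact: coord_continuous.
move=> u; apply: (@cvgB _ _ _ (nbhs u) (nbhs_filter u)); last exact: sum_cts.
exact: continuous_weight.
Qed.

(** After a small move into the relative interior of the cone, all the conditions on
    the matrix but one are strict inequalities, which persist nearby; [equalise]
    takes care of the remaining equality. *)
Lemma rational_in_edge_cone (R : realType) (n : nat) (s p : 'S_n) i0 (w : 'M[R]_n)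
    (A : set 'M[R]_n) :
  differ_by_cycle s p i0 -> s \in minimisers w -> p \in minimisers w -> nbhs w A ->
  exists v : 'M[rat]_n, A (map_mx ratr v) /\ minimisers v = [set s; p]%SET.
Proof.
move=> dsp smin pmin wA; have [sp _] := dsp.
pose f (e : R) := w + e *: edge_weight R s p.
have fc : continuous f.
  apply: continuous_mx => i j.
  have -> : (fun e => f e i j) = fun e => w i j + e * edge_weight R s p i j.
    by apply/funext => e; rewrite !mxE.
  move=> e; apply: cvgD; first exact: cvg_cst.
  by apply: cvgMl; exact: cvg_id.
have : \forall e \near (0 : R), nbhs (f e) A.
  by apply: (fc 0 (nbhs^~ A)); rewrite /f scale0r addr0; exact: nbhs_interior.
move=> /nbhs_ballP[d /= d0 dA]; pose e := d / 2.
have e0 : 0 < e by rewrite divr_gt0.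
have {dA} fA : nbhs (f e) A.
  by apply: dA; rewrite /ball /= sub0r normrN gtr0_norm// /e; lra.
have fmin : minimisers (f e) = [set s; p]%SET.
  exact: (minimisers_add_edge_weight dsp smin pmin e0).
have fsp : weight (f e) s = weight (f e) p.
  have sM : s \in minimisers (f e) by rewrite fmin !inE eqxx.
  by apply/esym/eqP; rewrite -(minimisers_eq _ sM) fmin !inE eqxx orbT.
(* The weights of [s] and [p] agree at [f e], so [equalise] fixes it. *)
have near_f : nbhs (f e) (A `&` [set u | minimisers u \subset [set s; p]%SET]).
  apply: filterI => //; rewrite -fmin; exact: minimisers_near.
have : nbhs (f e) (equalise s p i0 @^-1` (A `&` [set u | minimisers u \subset [set s; p]%SET])).
  by apply: continuous_equalise; rewrite equalise_id.
move=> /dense_rat_mx[v /=]; rewrite equalise_map minimisers_map => -[Av vsub].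
exists (equalise s p i0 v); split=> //.
apply/eqP; rewrite finset.eqEsubset vsub /=.
have [t tmin] := minimisers_neq0 (equalise s p i0 v).
have esp := equalise_weight v sp.
have tsp : t \in [set s; p]%SET by exact: (fintype.subsetP vsub).
have tw : weight (equalise s p i0 v) t = weight (equalise s p i0 v) s.
  by move: tsp; rewrite !inE => /orP[]/eqP ->.
rewrite finset.subUset !finset.sub1set !(minimisers_eq _ tmin) tw -esp.
by rewrite eqxx.
Qed.

(** * Cones of the tropical determinant *)

(** The last clause rests on the sign of the entry solved for in [zero_det_lift]: it is
    positive when the two permutations have opposite signs. *)
Lemma edge_lift (R : realType) (n : nat) (s p : 'S_n) i0 (w : 'M[R]_n) (A : set 'M[R]_n) :
  differ_by_cycle s p i0 -> s \in minimisers w -> p \in minimisers w -> nbhs w A ->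
  exists z : 'M[puiseux R]_n, [/\ det_hypersurface z, torus z, A (val_mx z) &
    odd_perm s != odd_perm p -> positive_orthant z].
Proof.
move=> dsp smin pmin wA.
have [v [Av vmin]] := rational_in_edge_cone dsp smin pmin wA.
have [z [z0 zE]] := zero_det_lift R (proj1 dsp) vmin.
have c0 i j : (if (i == i0) && (j == s i0) && (odd_perm s == odd_perm p) then -1 else 1)
    != 0 :> R[i].
  by case: ifP; rewrite ?oppr_eq0 oner_eq0.
exists z; split=> //.
- by move=> i j; exact: starts_at_neq0 (zE i j) (c0 i j).
- rewrite (_ : val_mx z = map_mx ratr v)//; apply/matrixP => i j; rewrite !mxE.
  by have [-> _] := starts_at_val (zE i j) (c0 i j).
- move=> /negPf sgn i j; rewrite /puiseux_positive /=.
  by have [_ ->] := starts_at_val (zE i j) (c0 i j); rewrite sgn andbF ltr01.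
Qed.

Lemma edge_cone_sub_trop_det (R : realType) (n : nat) (s p : 'S_n) i0 (w : 'M[R]_n) :
  differ_by_cycle s p i0 -> s \in minimisers w -> p \in minimisers w -> trop_det w.
Proof.
move=> dsp smin pmin A /(edge_lift dsp smin pmin)[z [z0 zt zA _]].
by exists (val_mx z); split=> //; exists z.
Qed.

Lemma edge_cone_sub_positive (R : realType) (n : nat) (s p : 'S_n) i0 (w : 'M[R]_n) :
  differ_by_cycle s p i0 -> s \in minimisers w -> p \in minimisers w ->
  odd_perm s != odd_perm p ->
  trop (@det_hypersurface R n `&` @positive_orthant R n) w.
Proof.
move=> dsp smin pmin sgn A /(edge_lift dsp smin pmin)[z [z0 zt zA zpos]].
exists (val_mx z); split=> //; exists z => //; split=> //; split=> //; exact: zpos.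
Qed.

(** With a single minimiser, the determinant of a nearby lift would have a single term
    of lowest order. *)
Lemma trop_det_two_minimisers (R : realType) (n : nat) (w : 'M[R]_n) :
  trop_det w -> exists s p, [/\ s \in minimisers w, p \in minimisers w & s != p].
Proof.
move=> /(_ _ (minimisers_near w))[_ [[z [z0 zt] <-] zsub]].
have [s smin] := minimisers_neq0 (val_mx z).
have [zs|/subsetPn[p pmin]] := boolP (minimisers (val_mx z) \subset [set s]%SET).
  have := @det_neq0_single R n z s zt; rewrite z0 eqxx => /(_ _)/negP[]//.
  by apply/eqP; rewrite finset.eqEsubset zs finset.sub1set.
rewrite inE => ps; exists s, p; rewrite eq_sym ps.
by split=> //; exact: (fintype.subsetP zsub).
Qed.

Lemma same_sign_not_positive (R : realType) (n : nat) (w : 'M[R]_n) (b : bool) :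
  (forall s, s \in minimisers w -> odd_perm s = b) ->
  ~ trop (@det_hypersurface R n `&` @positive_orthant R n) w.
Proof.
move=> wb /(_ _ (minimisers_near w))[_ [[z [[z0 zpos] zt] <-] zsub]].
have : \det z != 0.
  by apply: (@det_neq0_positive R n z b zt zpos) => s /(fintype.subsetP zsub)/wb.
by rewrite z0 eqxx.
Qed.

(** The cone of the edge found by exchanging two minimisers contains [C] and lies in the
    tropical determinant, so maximality makes them equal. Evaluation at a generic point
    of this cone then shows that [C] has no further dual permutation. *)
Lemma maximal_cone_edge (R : realType) (n : nat) (C : set 'M[R]_n) :
  maximal_cone C -> exists s p i0, [/\ differ_by_cycle s p i0,
    dual_perms C = [set s; p]%SET &
    C = [set w | s \in minimisers w /\ p \in minimisers w]].
Proof.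
move=> [[Cfan Ctrop] Cmax]; have [[w0 Lw0] CE] := dual_permsP Cfan.
have [s [p [smin pmin sp]]] : exists s p : 'S_n,
    [/\ s \in minimisers w0, p \in minimisers w0 & s != p].
  by apply: trop_det_two_minimisers; apply: Ctrop; rewrite CE /= Lw0.
have [i0 [p' [q [dsp ex]]]] := cycle_exchange sp.
have p'min := exchange_minimisers smin pmin ex.
exists s, p', i0; pose w1 := w0 + 1 *: edge_weight R s p'.
have w1min : minimisers w1 = [set s; p']%SET.
  exact: (minimisers_add_edge_weight dsp smin p'min ltr01).
pose C' : set 'M[R]_n := [set w | [set s; p']%SET \subset minimisers w].
have C'E w : C' w <-> s \in minimisers w /\ p' \in minimisers w.
  by rewrite /C' /= finset.subUset !finset.sub1set; split=> [/andP//|[-> ->]].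
have C'C : C' = C.
  apply: Cmax; last first.
    move=> w; rewrite CE /= Lw0 => /fintype.subsetP sub; apply/C'E.
    by split; exact: sub.
  split; last by move=> w /C'E[sw pw]; exact: edge_cone_sub_trop_det dsp sw pw.
  exists (conv_perm [set s; p']%SET).
  by rewrite /C' -w1min; exact: normal_fan_minimisers.
split=> //; last by rewrite -C'C; apply/seteqP; split=> w /C'E.
apply/eqP; rewrite finset.eqEsubset; apply/andP; split.
  have : C w1 by rewrite -C'C /C' /= w1min.
  by rewrite {1}CE /= w1min.
by rewrite Lw0 finset.subUset !finset.sub1set smin p'min.
Qed.

Theorem proposition4p2 (R : realType) (n : nat) (C : set 'M[R]_n)
    (hC : maximal_cone C) :
  exists l : nat,
    cycle_and_matching (Gamma C) (2 * l) /\ (positive_cone C <-> ~~ odd l).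
Proof.
have [s [p [i0 [dsp LE CE]]]] := maximal_cone_edge hC.
exists #|porbit (transition s p) i0|; split.
  by rewrite /Gamma LE; exact: edge_graph.
rewrite -(odd_differ_by_cycle dsp); split; last first.
  move=> sgn w; rewrite CE => -[smin pmin].
  exact: edge_cone_sub_positive dsp smin pmin sgn.
move=> Cpos; apply/negP => /eqP sgn.
(* A point whose minimisers are exactly the permutations dual to [C]. *)
have [[w0 w0E] _] := dual_permsP hC.1.1.
have Cw0 : C w0 by rewrite {1}CE /= -w0E LE !inE !eqxx orbT.
apply: (@same_sign_not_positive R n w0 (odd_perm p)) (Cpos _ Cw0) => t.
by rewrite -w0E LE !inE => /orP[]/eqP->.
Qed.
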